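(* Let $G$ be a graph and $B\subseteq V(G)$. If $B$ is a zero forcing set for $G$, then $B$ is a lazy burning set for the closed neighborhood hypergraph $\mathcal{N}[G]$. In particular, $b_L(\mathcal{N}[G])\le z(G)$.
   Context: Graphs are finite and simple. Zero forcing on $G$: an initial set of vertices is black, the rest white; repeatedly, a black vertex $u$ with exactly one white neighbor $w$ turns $w$ black. A zero forcing set is an initial black set from which all vertices eventually become black; $z(G)$ is the minimum size of one. The closed neighborhood hypergraph $\mathcal{N}[G]$ has vertex set $V(G)$ and hyperedges $N_G[v]=N_G(v)\cup\{v\}$ for $v\in V(G)$. Lazy burning on a hypergraph $H$: a set $B\subseteq V(H)$ is burned initially; in each subsequent round every unburned vertex $v$ for which some hyperedge $h\ni v$ has $h\setminus\{v\}$ entirely burned becomes burned. $B$ is a lazy burning set if eventually all vertices burn; $b_L(H)$ is the minimum size of one. *)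

(* Defs.v *)
From mathcomp Require Import all_boot.

Set Implicit Arguments.
Unset Strict Implicit.
Unset Printing Implicit Defensive.

Record sgraph := SGraph {
  vertex :> finType;
  adj : rel vertex;
  adj_sym : symmetric adj;
  adj_irr : irreflexive adj
}.

Definition nbhd (G : sgraph) (v : G) : {set G} := [set w | adj v w].

Definition closed_nbhd (G : sgraph) (v : G) : {set G} := v |: nbhd v.

(* A single force: some black [u] has [w] as its only white neighbor. *)
Definition force_step (G : sgraph) : rel {set G} := fun B B' =>
  [exists u in B, exists w, (nbhd u :\: B == [set w]) && (B' == w |: B)].

(* [connect] is the reflexive-transitive closure, so this says that some
   sequence of forces starting at [B] blackens every vertex.  Forces never
   disable one another (a later force of a blackened vertex is just redundant),
   so the order in which they are performed is immaterial. *)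
Definition zero_forcing_set (G : sgraph) (B : {set G}) : bool :=
  connect (@force_step G) B [set: G].

Lemma zero_forcing_setT (G : sgraph) : zero_forcing_set [set: G].
Proof. exact: connect0. Qed.

Definition zero_forcing_number (G : sgraph) : nat :=
  #|[arg min_(B < [set: G] | zero_forcing_set B) #|B|]|.

Lemma zero_forcing_numberP (G : sgraph) :
  (exists2 B : {set G}, zero_forcing_set B & #|B| = zero_forcing_number G) /\
  (forall B : {set G}, zero_forcing_set B -> zero_forcing_number G <= #|B|).
Proof.
rewrite /zero_forcing_number; case: arg_minnP; first exact: zero_forcing_setT.
by move=> B zfB minB; split=> //; exists B.
Qed.

Record hypergraph := Hypergraph {
  hvertex :> finType;
  hyperedges : {set {set hvertex}}
}.

Definition closed_nbhd_hypergraph (G : sgraph) : hypergraph :=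
  @Hypergraph G [set closed_nbhd v | v : G].

Definition burn_round (H : hypergraph) (B : {set H}) : {set H} :=
  B :|: [set v | [exists h in hyperedges H, (v \in h) && (h :\ v \subset B)]].

(* [fconnect f x y] holds iff [y] is some iterate [iter n f x]. *)
Definition lazy_burning_set (H : hypergraph) (B : {set H}) : bool :=
  fconnect (@burn_round H) B [set: H].

Lemma lazy_burning_setT (H : hypergraph) : lazy_burning_set [set: H].
Proof. exact: connect0. Qed.

Definition lazy_burning_number (H : hypergraph) : nat :=
  #|[arg min_(B < [set: H] | lazy_burning_set B) #|B|]|.

Lemma lazy_burning_numberP (H : hypergraph) :
  (exists2 B : {set H}, lazy_burning_set B & #|B| = lazy_burning_number H) /\
  (forall B : {set H}, lazy_burning_set B -> lazy_burning_number H <= #|B|).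
Proof.
rewrite /lazy_burning_number; case: arg_minnP; first exact: lazy_burning_setT.
by move=> B lbB minB; split=> //; exists B.
Qed.

(* Main.v *)
(** A force of [w] by the black vertex [u] is also a burning move, through the
    hyperedge [N[u]], all of whose vertices other than [w] are black.  As a
    burning round is monotone, the burned set stays above the black set. *)
Require Import Defs.
From mathcomp Require Import all_boot.

Lemma burn_round_mono (H : hypergraph) (B C : {set H}) :
  B \subset C -> burn_round B \subset burn_round C.
Proof.
move=> sBC; apply: setUSS => //; apply/subsetP => v; rewrite !inE.
case/exists_inP => h hH /andP[vh sB]; apply/exists_inP; exists h => //.
by rewrite vh (subset_trans sB sBC).
Qed.

Lemma force_step_burn_round (G : sgraph) (B B' : {set G}) :
  force_step B B' -> B' \subset @burn_round (closed_nbhd_hypergraph G) B.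
Proof.
case/exists_inP => u uB /existsP[w /andP[/eqP whiteN /eqP ->]].
rewrite subUset subsetUl andbT sub1set !inE; apply/orP; right.
apply/exists_inP; exists (closed_nbhd u); first exact: imset_f.
have : w \in nbhd u :\: B by rewrite whiteN set11.
case/setDP => wN _; apply/andP; split; first by rewrite inE wN orbT.
apply/subsetP => x /setD1P[xw /setU1P[-> //|xN]].
by apply: contraR xw => xB; rewrite -in_set1 -whiteN inE xB xN.
Qed.

(** One round absorbs each force. Only inclusion can be expected, since a round may burn several
    vertices at once. *)
Lemma connect_force_iter_burn (G : sgraph) (B B' : {set G}) :
  connect (@force_step G) B B' ->
  exists n, B' \subset iter n (@burn_round (closed_nbhd_hypergraph G)) B.
Proof.
(* Induction removes the last force because [iter n.+1] applies its extra round last. *)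
case/connectP => p + ->; elim/last_ind: p => [|p C IHp] /=; first by exists 0.
rewrite rcons_path last_rcons => /andP[/IHp[n sn] /force_step_burn_round sC].
exists n.+1; apply: (subset_trans sC).
exact: (burn_round_mono (closed_nbhd_hypergraph G) _ _ sn).
Qed.

Theorem theorem4p4 (G : sgraph) :
  (forall B : {set G},
     zero_forcing_set B -> @lazy_burning_set (closed_nbhd_hypergraph G) B) /\
  lazy_burning_number (closed_nbhd_hypergraph G) <= zero_forcing_number G.
Proof.
have zf_lb (B : {set G}) :
    zero_forcing_set B -> @lazy_burning_set (closed_nbhd_hypergraph G) B.
  case/connect_force_iter_burn => n; rewrite subTset => /eqP burnT.
  (* Only the target [[set: G]] is replaced by the iterate equal to it. *)
  by rewrite /lazy_burning_set -[X in fconnect _ _ X]burnT fconnect_iter.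
split=> //; have [[B /zf_lb lbB <-] _] := zero_forcing_numberP G.
by have [_ /(_ B lbB)] := lazy_burning_numberP (closed_nbhd_hypergraph G).
Qed.
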